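(* Suppose the power injections follow the Ornstein-Uhlenbeck model, i.e. for every $\mu\in\mathbb R^m$ one has $b_i(x)=\gamma_i(\mu_i-x)$ and $l_i(x)=l_i$ constant, with $\gamma_i,l_i>0$ for $i=1,\dots,m$; put $D=\mathrm{diag}(\gamma_1,\dots,\gamma_m)$, $\mathsf L=\mathrm{diag}(l_1,\dots,l_m)$ and $M_T=\mathsf L^2D^{-1}(I-e^{-2DT})$. Let $\tau_\ell>0$ for all $\ell\in\mathcal L$. Then for all $\overline\mu\in\mathcal A$ $$\mathcal I_{\mathrm{tmp},\tau}^{(LB)}(\overline\mu)=\min_{\ell\in\mathcal L'}\frac{(\alpha_\ell-|\nu_\ell|)^2}{C_\ell M_TC_\ell^\top},$$ and $$\tilde{\mathcal R}^{(\mathrm{tmp},\tau,LB)}_{\epsilon,p}=\bigcap_{\ell\in\mathcal L'}\Bigl\{\overline\mu\in\mathcal A:\ \frac{(\alpha_\ell-|\nu_\ell|)^2}{C_\ell M_TC_\ell^\top}\ge-\epsilon\log p\Bigr\},$$ where $\alpha_\ell=\sqrt{\frac{1-\nu_\ell^2e^{-T/\tau_\ell}}{1-e^{-T/\tau_\ell}}}$. In the particular case $D=\gamma I$ with $\gamma>0$, put $\sigma_\ell^2=C_\ell\mathsf L^2C_\ell^\top$ and $\eta_\ell=\sqrt{\frac{\epsilon\log(1/p)\,\sigma_\ell^2\,(1-e^{-2\gamma T})}{\gamma}}$, and assume $\eta_\ell<1$ for all $\ell\in\mathcal L'$; then $$\tilde{\mathcal R}^{(\mathrm{tmp},\tau,LB)}_{\epsilon,p}=\bigcap_{\ell\in\mathcal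 L'}\{\overline\mu\in\mathcal A:\ |\nu_\ell|\le\delta_\ell\},\qquad \delta_\ell=\sqrt{1-\eta_\ell^2e^{-T/\tau_\ell}(1-e^{-T/\tau_\ell})}-\eta_\ell(1-e^{-T/\tau_\ell}).$$
   Context: Network. $\mathcal G=(\mathcal N,\mathcal L)$ is a finite connected graph with nodes $\{0,1,\dots,N\}$, arbitrarily oriented edges (lines) $\ell\in\mathcal L$ and weights $w_\ell>0$. $A\in\mathbb R^{|\mathcal L|\times(N+1)}$ is the incidence matrix ($A_{\ell,i}=1$ if $\ell=(i,j)$, $-1$ if $\ell=(j,i)$, $0$ otherwise), $W=\mathrm{diag}(w_\ell)$, $B=A^\top WA$, $\hat B$ is $B$ with the row and column of node $0$ deleted, $\breve B=\begin{pmatrix}0&0\\0&\hat B^{-1}\end{pmatrix}$, $\Lambda=\mathrm{diag}(1/I_{\ell,\max})$ with constants $I_{\ell,\max}>0$, and $\overline C=\Lambda WA\breve B$. Fix $1\le m\le N$; $C$ consists of columns $1,\dots,m$ of $\overline C$ and $C_D$ of columns $m+1,\dots,N$. For $\overline\mu=(\mu,\mu_D)\in\mathbb R^m\times\mathbb R^{N-m}=\mathbb R^N$ put $y=C_D\mu_D$ and $\nu=C\mu+y$. $C_\ell$ is the $\ell$-th row of $C$ and $\mathcal L'=\{\ell\in\mathcal L: C_\ell\ne0\}$. Admissible initial conditions. $\mathcal A=\{\overline\mu\in\mathbb R^N: |\nu_\ell|\le1 \text{ for all } \ell\in\mathcal L,\ |\nu_\ell|<1\text{ for all }\ell\notin\mathcal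 L'\}$. Rate function. $T>0$. $H^1_\mu$ is the set of $g:[0,T]\to\mathbb R^m$ with $g(t)=\mu+\int_0^t\phi(s)\,ds$, $\phi\in L_2([0,T])$. For $g\in H^1_\mu$, $\mathcal I_{\mathrm{pow}}(g)=\sum_{i=1}^m\frac12\int_0^T\left(\frac{g_i'-b_i(g_i)}{l_i(g_i)}\right)^2dt$. Inner bound. For $\ell\in\mathcal L'$ and $a\in\mathbb R$, $\psi_\ell^{(a)}=\inf\{\mathcal I_{\mathrm{pow}}(g): g\in H^1_\mu,\ y_\ell+C_\ell g(T)=a\}$; $\mathcal I_{\mathrm{tmp},\tau}^{(LB)}(\overline\mu)=\min_{\ell\in\mathcal L'}\min\{\psi_\ell^{(\alpha_\ell)},\psi_\ell^{(-\alpha_\ell)}\}$. For $\epsilon>0$ and $p\in(0,1)$, $\tilde{\mathcal R}^{(\mathrm{tmp},\tau,LB)}_{\epsilon,p}=\{\overline\mu\in\mathcal A:\mathcal I_{\mathrm{tmp},\tau}^{(LB)}(\overline\mu)\ge-\epsilon\log p\}$. *)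

(* Defs.v *)
From mathcomp Require Import all_boot all_order all_algebra.
From mathcomp Require Import all_classical all_reals all_analysis.

Set Implicit Arguments.
Unset Strict Implicit.
Unset Printing Implicit Defensive.

Import Order.TTheory GRing.Theory Num.Theory.
Import numFieldNormedType.Exports.

Local Open Scope classical_set_scope.
Local Open Scope ring_scope.

(* Line l is oriented from [src l] to [dst l].  Self-loops are excluded;
   parallel lines are allowed, as nothing depends on their absence. *)
Record network (R : realType) (N : nat) := Network {
  nlines : nat;
  src : 'I_nlines -> 'I_N.+1;
  dst : 'I_nlines -> 'I_N.+1;
  weight : 'I_nlines -> R;
  Imax : 'I_nlines -> R;
  src_neq_dst : forall l, src l != dst l;
  network_connected : forall i j : 'I_N.+1,
    connect (fun a b => [exists l, ((src l == a) && (dst l == b))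
                                || ((src l == b) && (dst l == a))]) i j;
  weight_gt0 : forall l, 0 < weight l;
  Imax_gt0 : forall l, 0 < Imax l }.

Definition incidence (R : realType) (N : nat) (G : network R N) :
    'M[R]_(nlines G, N.+1) :=
  \matrix_(l, i) if i == src l then 1 else if i == dst l then -1 else 0.

Definition weight_mx (R : realType) (N : nat) (G : network R N) :
    'M[R]_(nlines G) :=
  diag_mx (\row_l weight l).

Definition Bmx (R : realType) (N : nat) (G : network R N) : 'M[R]_N.+1 :=
  (incidence G)^T *m weight_mx G *m incidence G.

Definition Bhat (R : realType) (N : nat) (G : network R N) : 'M[R]_N :=
  row' ord0 (col' ord0 (Bmx G)).

Definition Bbreve (R : realType) (N : nat) (G : network R N) : 'M[R]_N.+1 :=
  block_mx (0 : 'M[R]_1) 0 0 (invmx (Bhat G)).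

Definition Lambda_mx (R : realType) (N : nat) (G : network R N) :
    'M[R]_(nlines G) :=
  diag_mx (\row_l (Imax l)^-1).

(* The columns of [Cbar] are numbered from 0 to N, like the nodes. *)
Definition Cbar (R : realType) (N : nat) (G : network R N) :
    'M[R]_(nlines G, N.+1) :=
  Lambda_mx G *m weight_mx G *m incidence G *m Bbreve G.

(* Columns 1, ..., m of [Cbar]; [inord] is meaningful when m <= N. *)
Definition Cmx (R : realType) (N : nat) (G : network R N) (m : nat) :
    'M[R]_(nlines G, m) :=
  \matrix_(l, i) Cbar G l (inord i.+1).

(* Columns m+1, ..., N of [Cbar]. *)
Definition CDmx (R : realType) (N : nat) (G : network R N) (m : nat) :
    'M[R]_(nlines G, N - m) :=
  \matrix_(l, j) Cbar G l (inord (m + j).+1).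

(* A point (mu, mu_D) of R^N = R^m x R^(N-m). *)
Definition mean (R : realType) (N m : nat) : Type :=
  ('cV[R]_m * 'cV[R]_(N - m))%type.

Definition yvec (R : realType) (N : nat) (G : network R N) (m : nat)
    (mub : mean R N m) : 'cV[R]_(nlines G) :=
  CDmx G m *m mub.2.

Definition nu (R : realType) (N : nat) (G : network R N) (m : nat)
    (mub : mean R N m) : 'cV[R]_(nlines G) :=
  Cmx G m *m mub.1 + yvec G mub.

Definition Lprime (R : realType) (N : nat) (G : network R N) (m : nat) :
    pred 'I_(nlines G) :=
  fun l => row l (Cmx G m) != 0.

Arguments Lprime {R N} G m _.

Definition admissible (R : realType) (N : nat) (G : network R N) (m : nat) :
    set (mean R N m) :=
  [set mub | (forall l, `|nu G mub l 0| <= 1) /\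
             (forall l, ~~ Lprime G m l -> `|nu G mub l 0| < 1)].

(* Paths are total functions on R of which only the restriction to [0, T] is
   constrained.  The derivative phi is in L_2([0, T]) componentwise. *)
Definition H1 (R : realType) (m : nat) (T : R) (mu : 'cV[R]_m) :
    set (R -> 'cV[R]_m) :=
  [set g | exists2 phi : R -> 'cV[R]_m,
     forall i, (fun t => phi t i 0) \_ `[0, T]
                 \in Lfun (@lebesgue_measure R) 2%:E &
     forall t, t \in `[0, T] ->
       g t = mu + \col_i \int[@lebesgue_measure R]_(s in `[0, t]) phi s i 0].

(* [b i] and [l i] are the drift and diffusion coefficients of the i-th
   injection.  Paths in [H1] are differentiable almost everywhere on [0, T], so
   the value of the total operator [derive1] elsewhere is irrelevant. *)
Definition Ipow (R : realType) (m : nat) (T : R) (b l : 'I_m -> R -> R)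
    (g : R -> 'cV[R]_m) : \bar R :=
  (\sum_(i < m) (2^-1)%:E *
     \int[@lebesgue_measure R]_(t in `[0%R, T])
       (((derive1 (fun s => g s i 0) t - b i (g t i 0)) / l i (g t i 0)) ^+ 2)%:E)%E.

(* The coefficients [b mu] and [l mu] may depend on the mean mu of the
   injections. *)
Definition psi (R : realType) (N : nat) (G : network R N) (m : nat) (T : R)
    (b l : 'cV[R]_m -> 'I_m -> R -> R) (mub : mean R N m)
    (k : 'I_(nlines G)) (a : R) : \bar R :=
  ereal_inf [set Ipow T (b mub.1) (l mub.1) g | g in
    [set g | H1 T mub.1 g /\
             yvec G mub k 0 + (row k (Cmx G m) *m g T) 0 0 = a]].

Definition alpha (R : realType) (N : nat) (G : network R N) (m : nat) (T : R)
    (tau : 'I_(nlines G) -> R) (mub : mean R N m) (k : 'I_(nlines G)) : R :=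
  Num.sqrt ((1 - nu G mub k 0 ^+ 2 * expR (- T / tau k))
            / (1 - expR (- T / tau k))).

(* [Lprime] is nonempty when 1 <= m <= N because the network is connected, so
   the neutral element +oo plays no role in the minimum. *)
Definition I_LB (R : realType) (N : nat) (G : network R N) (m : nat) (T : R)
    (tau : 'I_(nlines G) -> R) (b l : 'cV[R]_m -> 'I_m -> R -> R)
    (mub : mean R N m) : \bar R :=
  (\big[mine/+oo]_(k | Lprime G m k)
     mine (psi T b l mub k (alpha T tau mub k))
          (psi T b l mub k (- alpha T tau mub k)%R))%E.

Definition R_LB (R : realType) (N : nat) (G : network R N) (m : nat) (T : R)
    (tau : 'I_(nlines G) -> R) (b l : 'cV[R]_m -> 'I_m -> R -> R)
    (eps p : R) : set (mean R N m) :=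
  [set mub | admissible G mub /\ ((- eps * ln p)%:E <= I_LB T tau b l mub)%E].

(* The matrix exponential, as the entrywise limit of its power series. *)
Definition expmx (R : realType) (m : nat) (A : 'M[R]_m) : 'M[R]_m :=
  \matrix_(i, j)
    limn (fun n => (\sum_(0 <= k < n) (k`!%:R)^-1 *: A ^+ k) i j).

(* Main.v *)
(* Put Q_k = C_k M_T C_k^T.  If g_i' + gamma_i (g_i - mu_i) = l_i u_i, then
   g_i(T) - mu_i is the integral over [0, T] of
   e^{-gamma_i (T - s)} l_i u_i(s), so the constraint y_k + C_k g(T) = a
   prescribes the L_2 inner product of u with v, where
   v_i(s) = C_ki l_i e^{-gamma_i (T - s)} and |v|^2 = Q_k / 2.  The control of
   least energy is a multiple of v, whence psi_k^(a) = (a - nu_k)^2 / Q_k.  The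
   smaller of the values at a = alpha_k and a = - alpha_k is
   (alpha_k - |nu_k|)^2 / Q_k, and for D = gamma I the condition
   alpha_k - |nu_k| >= eta_k is a quadratic inequality in |nu_k|.  The network
   enters only through the nonemptiness of L': the reduced Laplacian is
   invertible because potentials without flow on a connected network are
   constant. *)
Require Import Defs.
From mathcomp Require Import all_boot all_order all_algebra.
From mathcomp Require Import all_classical all_reals all_analysis.
From mathcomp Require Import measurable_realfun ring lra.

Set Implicit Arguments.
Unset Strict Implicit.
Unset Printing Implicit Defensive.

Import Order.TTheory GRing.Theory Num.Theory.
Import numFieldNormedType.Exports.

Local Open Scope classical_set_scope.
Local Open Scope ring_scope.

(** * Lebesgue integration *)

(* Unlike [ge0_le_integral], no measurability is required: the integral of a
   nonnegative function is a supremum over the simple functions below it. *)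
Lemma ge0_le_integral_nonmeasurable d (T : measurableType d) (R : realType)
    (mu : {measure set T -> \bar R}) (D : set T) (f g : T -> \bar R) :
  (forall x, D x -> 0 <= f x)%E -> (forall x, D x -> f x <= g x)%E ->
  (\int[mu]_(x in D) f x <= \int[mu]_(x in D) g x)%E.
Proof.
move=> f0 fg; rewrite !ge0_integralE//; last first.
  by move=> x Dx; exact: le_trans (f0 _ Dx) (fg _ Dx).
apply: ereal_sup_le => _ [h /= hf <-]; exists h => //= x.
apply: le_trans (hf x) _; rewrite !patchE; case: ifPn => // /set_mem.
exact: fg.
Qed.

(** The kernel is dominated by |f(y)| |g(x)|, whose iterated integral is the product of two finite
    L^1 norms. This licenses Fubini in [Rintegral_duhamel]. *)
Lemma integrable_triangle_kernel (R : realType) (f g : R -> R) :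
  let mu := @lebesgue_measure R in
  mu.-integrable setT (EFin \o f) -> mu.-integrable setT (EFin \o g) ->
  (mu \x mu)%E.-integrable setT
    (fun z : R * R => (f z.2 * g z.1 * (z.2 <= z.1)%R%:R)%:E).
Proof.
move=> mu intf intg.
have mf : measurable_fun setT f by apply/measurable_EFinP; case/integrableP: intf.
have mg : measurable_fun setT g by apply/measurable_EFinP; case/integrableP: intg.
have mK : measurable_fun setT
    (fun z : R * R => (f z.2 * g z.1 * (z.2 <= z.1)%R%:R)).
  apply: measurable_funM.
    by apply: measurable_funM; apply: measurableT_comp.
  apply: (measurableT_comp (f := fun b : bool => b%:R : R)) => //.
  exact: measurable_fun_ler.
apply/integrable12ltyP; first exact/measurable_EFinP.
have /integrableP[_ foo] := intf; have /integrableP[_ goo] := intg.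
apply: (@le_lt_trans _ _ (\int[mu]_x (`|(g x)%:E| * \int[mu]_y `|(f y)%:E|))%E).
  apply: ge0_le_integral_nonmeasurable => [x _|x _]; first exact: integral_ge0.
  rewrite -ge0_integralZl//; last first.
    by apply/measurable_EFinP; exact: measurableT_comp.
  apply: ge0_le_integral_nonmeasurable => // y _ /=.
  rewrite lee_fin !normrM [X in X * _]mulrC -[leRHS]mulr1 ler_wpM2l ?mulr_ge0//.
  by case: (y <= x); rewrite ?normr1 ?normr0.
have ffin : (\int[mu]_y `|(f y)%:E|)%E \is a fin_num.
  by rewrite ge0_fin_numE// integral_ge0.
rewrite -(fineK ffin) ge0_integralZr//.
- by rewrite muleC; apply: lte_mul_pinfty => //;
    rewrite lee_fin fine_ge0 ?integral_ge0.
- by apply/measurable_EFinP; exact: measurableT_comp.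
- by rewrite lee_fin fine_ge0 ?integral_ge0.
Qed.

Lemma derive_expR_affine (R : realType) (c d x : R) :
  is_derive x 1 (fun s : R => expR (c * s + d)) (c * expR (c * x + d)).
Proof.
have dl : is_derive x 1 (fun s : R => c * s + d) c.
  by apply: is_derive_eq; rewrite ?addr0 ?scaler1 ?mulr1.
have := @is_derive1_comp _ expR (fun s => c * s + d) x _ _ (is_derive_expR _) dl.
by rewrite mulrC.
Qed.

Lemma continuous_expR_affine (R : realType) (c d : R) :
  continuous (fun s : R => expR (c * s + d)).
Proof.
move=> x; apply/differentiable_continuous/derivable1_diffP.
by case: (derive_expR_affine c d x).
Qed.

(** The case a = b is included because the integrals over [x, T] and [0, t] below can degenerate to
    a point. *)
Lemma derivable_continuous_FTC2 (R : realType) (F f : R -> R) (a b : R) :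
  (forall x : R, is_derive x 1 F (f x)) -> continuous f -> a <= b ->
  (\int[@lebesgue_measure R]_(x in `[a, b]) (f x)%:E = (F b - F a)%:E)%E.
Proof.
move=> dF cf; rewrite le_eqVlt => /predU1P[<-|ab].
  by rewrite set_itv1 integral_set1 subrr.
have cF : continuous F.
  by move=> x; apply/differentiable_continuous/derivable1_diffP; case: (dF x).
rewrite (@continuous_FTC2 _ f F a b ab)//.
- exact: continuous_subspaceT.
- split.
  + by move=> x _; case: (dF x).
  + exact/cvg_at_right_filter/cF.
  + exact/cvg_at_left_filter/cF.
- by move=> x _; rewrite derive1E; apply: derive_val.
Qed.

Lemma integrable_continuousM (R : realType) (a b : R) (h f : R -> R) :
  continuous h ->
  (@lebesgue_measure R).-integrable `[a, b] (EFin \o f) ->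
  (@lebesgue_measure R).-integrable `[a, b] (EFin \o (fun s => h s * f s)).
Proof.
move=> ch intf.
have [M [Mr hM]] : bounded_set (h @` `[a, b]).
  apply/compact_bounded/continuous_compact; last exact: segment_compact.
  exact: continuous_subspaceT.
have hE : (EFin \o (fun s => h s * f s)) = ((EFin \o h) \* (EFin \o f))%E by [].
rewrite hE; apply: integrableMr => //.
  exact: measurable_funS (continuous_measurable_fun ch).
by exists M; split => // x Mx s sab; apply: hM => //; exists s.
Qed.

(* Integration by parts for an antiderivative that need not be continuously
   differentiable: Fubini over the triangle [r <= s]. *)
Lemma Rintegral_duhamel (R : realType) (c T : R) (phi : R -> R) :
  let mu := @lebesgue_measure R in
  let E s := expR (c * s + - (c * T)) in
  let X s := \int[mu]_(r in `[0, s]) phi r in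
  mu.-integrable `[0, T] (EFin \o phi) ->
  mu.-integrable `[0, T] (EFin \o (fun s => E s * (phi s + c * X s))) /\
  \int[mu]_(s in `[0, T]) (E s * (phi s + c * X s)) =
    \int[mu]_(s in `[0, T]) phi s.
Proof.
move=> mu E X iphi.
have cE : continuous E by exact: continuous_expR_affine.
have cE' : continuous (fun s => c * E s).
  by move=> x; apply: cvgM; [exact: cvg_cst|exact: cE].
have i1 : mu.-integrable `[0, T] (EFin \o cst (1 : R)).
  apply: continuous_compact_integrable; first exact: segment_compact.
  by apply: continuous_subspaceT => x; exact: cvg_cst.
(* Extension by zero moves the double integral of phi(x) E'(y) over 0 <= x <= y <= T to the whole
   plane, with E' = c E. *)
pose f := phi \_ `[0, T]; pose g := (fun s => c * E s) \_ `[0, T].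
have intf : mu.-integrable setT (EFin \o f).
  by rewrite /f -restrict_EFin -integrable_mkcond.
have intg : mu.-integrable setT (EFin \o g).
  rewrite /g -restrict_EFin -integrable_mkcond//.
  have := integrable_continuousM cE' i1.
  by congr (integrable _ _ _); apply/funext => s /=; rewrite mulr1.
have iK := integrable_triangle_kernel intf intg.
(* Integrating in y first gives phi(x) (E(T) - E(x)), and E(T) = 1. *)
have KF x : (\int[mu]_y (f x * g y * (x <= y)%R%:R)%:E)%E =
    (((fun s => (1 - E s) * phi s) \_ `[0, T]) x)%:E.
  rewrite [in RHS]patchE; case: ifPn => [xm|xT]; last first.
    by rewrite integral0_eq// => y _; rewrite /f patchE (negbTE xT) !mul0r.
  have := set_mem xm; rewrite /= in_itv/= => /andP[x0 xT'].
  transitivity (\int[mu]_(y in `[x, T]) (phi x * (c * E y))%:E)%E.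
    rewrite [RHS]integral_mkcond; apply: eq_integral => y _.
    rewrite /f /g !patchE xm.
    case: ifPn => [/set_mem/=|/negP yT].
      rewrite in_itv/= => /andP[y0 yT]; case: ifPn => [/set_mem/=|/negP xyT].
        by rewrite in_itv/= => /andP[-> _]; rewrite mulr1.
      case: (leP x y) => xy; last by rewrite mulr0.
      by case: xyT; apply/mem_set; rewrite /= in_itv/= xy.
    rewrite mulr0 mul0r; case: ifPn => // /set_mem/=.
    rewrite in_itv/= => /andP[xy yT']; case: yT; apply/mem_set.
    by rewrite /= in_itv/= yT' (le_trans x0).
  under eq_integral do rewrite EFinM.
  rewrite integralZl//; last first.
    have i1x : mu.-integrable `[x, T] (EFin \o cst (1 : R)).
      apply: continuous_compact_integrable; first exact: segment_compact.
      by apply: continuous_subspaceT => ?; exact: cvg_cst.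
    have := integrable_continuousM cE' i1x.
    by congr (integrable _ _ _); apply/funext => s /=; rewrite mulr1.
  rewrite (derivable_continuous_FTC2 (derive_expR_affine c (- (c * T))) cE' xT').
  by rewrite -EFinM /E subrr expR0 mulrC.
(* Integrating in x first collects phi into its primitive X(y). *)
have KG y : (\int[mu]_x (f x * g y * (x <= y)%R%:R)%:E)%E =
    (((fun s => c * E s * X s) \_ `[0, T]) y)%:E.
  rewrite [in RHS]patchE; case: ifPn => [ym|yT]; last first.
    by rewrite integral0_eq// => x _; rewrite /g patchE (negbTE yT) mulr0 mul0r.
  have := set_mem ym; rewrite /= in_itv/= => /andP[y0 yT'].
  have iphiy : mu.-integrable `[0, y] (EFin \o phi).
    apply: integrableS iphi => // r /=; rewrite !in_itv/= => /andP[-> ry].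
    exact: le_trans yT'.
  transitivity (\int[mu]_(x in `[0%R, y]) (c * E y * phi x)%:E)%E.
    rewrite [RHS]integral_mkcond; apply: eq_integral => x _.
    rewrite /f /g !patchE ym.
    case: ifPn => [/set_mem/=|/negP xT].
      rewrite in_itv/= => /andP[x0 xT]; case: ifPn => [/set_mem/=|/negP xyT].
        by rewrite in_itv/= => /andP[_ ->]; rewrite mulr1 mulrC.
      case: (leP x y) => xy; last by rewrite mulr0.
      by case: xyT; apply/mem_set; rewrite /= in_itv/= x0.
    rewrite !mul0r; case: ifPn => // /set_mem/=.
    rewrite in_itv/= => /andP[x0 xy]; case: xT; apply/mem_set.
    by rewrite /= in_itv/= x0 (le_trans xy).
  under eq_integral do rewrite EFinM.
  rewrite integralZl// [RHS]EFinM; congr (_ * _)%E.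
  by rewrite /X /Rintegral fineK//; exact: integrable_fin_num.
have iX : mu.-integrable `[0, T] (EFin \o (fun s => c * E s * X s)).
  have := integrable_fubini_F iK; rewrite /fubini_F/=.
  under eq_fun do rewrite KG.
  by move=> iX; apply/integrable_mkcond => //; rewrite restrict_EFin.
have EX : \int[mu]_(s in `[0, T]) (c * E s * X s) =
    \int[mu]_(s in `[0, T]) ((1 - E s) * phi s).
  rewrite /Rintegral; congr fine.
  have := Fubini iK => /=.
  under eq_integral do rewrite KG.
  under [X in _ = X]eq_integral do rewrite KF.
  have mkc (h : R -> R) : (\int[mu]_(s in `[0%R, T]) (h s)%:E =
      \int[mu]_s ((h \_ `[0%R, T]) s)%:E)%E.
    rewrite integral_mkcond; apply: eq_integral => s _.
    by rewrite !patchE; case: ifP.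
  by rewrite !mkc.
have iEp := integrable_continuousM cE iphi.
have splitE s : E s * (phi s + c * X s) = E s * phi s + c * E s * X s by ring.
split.
  have := integrableD _ iEp iX => /(_ (measurable_itv _)).
  by congr (integrable _ _ _); apply/funext => s /=; rewrite splitE.
under eq_Rintegral do rewrite splitE.
rewrite RintegralD// EX -RintegralD//.
  by apply: eq_Rintegral => s _; ring.
apply: integrable_continuousM => // x.
by apply: cvgB; [exact: cvg_cst|exact: cE].
Qed.

Lemma EFin_Rintegral d (T : measurableType d) (R : realType)
    (mu : {measure set T -> \bar R}) (D : set T) (f : T -> R) :
  measurable D -> mu.-integrable D (EFin \o f) ->
  (\int[mu]_(x in D) f x)%:E = (\int[mu]_(x in D) (f x)%:E)%E.
Proof. by move=> mD intf; rewrite fineK//; exact: integrable_fin_num. Qed.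

(** Meant for [g] a cost integrand containing [derive1], known only almost everywhere. The null set
    is removed from the integral of [f] alone; what remains is at most the integral of the positive
    part of [f], which lies below [g] pointwise there. *)
Lemma ae_le_integral_nonmeasurable d (T : measurableType d) (R : realType)
    (mu : {measure set T -> \bar R}) (D : set T) (f g : T -> \bar R) :
  measurable D -> mu.-integrable D f -> (forall x, D x -> 0 <= g x)%E ->
  {ae mu, forall x, D x -> (f x <= g x)%E} ->
  (\int[mu]_(x in D) f x <= \int[mu]_(x in D) g x)%E.
Proof.
move=> mD intf g0 [N [mN N0 fgN]]; rewrite (negligible_integral mN mD intf N0).
apply: (@le_trans _ _ (\int[mu]_(x in D `\` N) (f^\+ x))%E).
  rewrite [leLHS]integralE -[leRHS]sube0; apply: leeB => //.
  exact: integral_ge0.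
rewrite [leLHS]integral_mkcond [leRHS]integral_mkcond.
apply: ge0_le_integral_nonmeasurable => x _.
  by rewrite patchE; case: ifP.
rewrite !patchE; case: ifPn => [/set_mem[Dx Nx]|_].
  rewrite mem_set// funeposE ge_max g0// andbT.
  by apply: contrapT => fgx; apply: Nx; apply: fgN => /(_ Dx).
by case: ifPn => // /set_mem; exact: g0.
Qed.

(** Lebesgue differentiation, applied to the extension of [phi] by zero. *)
Lemma ae_derive1_primitive (R : realType) (T mu0 : R) (phi g : R -> R) :
  let mu := @lebesgue_measure R in
  mu.-integrable `[0, T] (EFin \o phi) ->
  (forall t, t \in `[0, T] -> g t = mu0 + \int[mu]_(s in `[0, t]) phi s) ->
  {ae mu, forall t, t \in `[0, T] -> derive1 g t = phi t}.
Proof.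
move=> mu iphi gE.
pose f := phi \_ `[0, T].
have intf : mu.-integrable setT (EFin \o f).
  by rewrite /f -restrict_EFin -integrable_mkcond.
have /FTC1 : forall y, mu.-integrable [set` Interval (BLeft 0) (BRight y)] (EFin \o f).
  by move=> y; exact: integrableS intf.
move=> /(_ (integrable_locally (measurable_itv _) iphi)) /= ftc.
(* The end points 0 and T are discarded: [derive1] is two-sided, while [g] is prescribed on [0, T]
   only. *)
have ae_neq (a : R) : {ae mu, forall t, t != a}.
  exists [set a]; split; [exact: measurable_set1|exact: lebesgue_measure_set1|].
  by move=> t /= /negP; rewrite negbK => /eqP.
have aeF := ae_filter_ringOfSetsType mu.
apply: (@filterS3 _ _ aeF _ _ _ _ _ ftc (ae_neq 0) (ae_neq T)) => t {}ftc t0 tT t0T.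
have {t0 tT} /andP[t0 tT] : 0 < t < T.
  move: t0T; rewrite in_itv/= => /andP[t0T tT'].
  by rewrite !lt_neqAle t0T tT' tT eq_sym t0.
have [dF F'] := ftc t0.
pose F (x : R) := \int[mu]_(s in `[0, x]) f s.
have nearF : \near t, mu0 + F t = g t.
  near=> s.
  have s0T : s \in `[0, T].
    rewrite in_itv/=; apply/andP; split; apply/ltW; near: s.
      exact: lt_nbhsr.
    exact: lt_nbhsl.
  rewrite gE//; congr (_ + _); apply: eq_Rintegral => r /set_mem/= rs.
  rewrite /f patchE mem_set//=; move: rs s0T; rewrite !in_itv/=.
  by move=> /andP[-> rs] /andP[_]; exact: le_trans.
rewrite derive1E -(near_eq_derive _ nearF) deriveD//.
rewrite derive_cst add0r -derive1E F' /f patchE mem_set//.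
Unshelve. all: by end_near. Qed.

Lemma continuous_restrict_Lfun2 (R : realType) (a b : R) (f : R -> R) :
  continuous f -> f \_ `[a, b] \in Lfun (@lebesgue_measure R) 2%:E.
Proof.
move=> cf; have mf := continuous_measurable_fun cf.
rewrite inE; apply/andP; split; rewrite inE/=.
  by apply/(measurable_restrictT _ _).1 => //; exact: measurable_funTS.
rewrite /finite_norm unlock poweR_lty//.
have i2 : (@lebesgue_measure R).-integrable `[a, b] (EFin \o (fun x => f x ^+ 2)).
  apply: continuous_compact_integrable; first exact: segment_compact.
  apply: continuous_subspaceT => x; under eq_fun do rewrite expr2.
  by apply: cvgM; exact: cf.
have : (\int[@lebesgue_measure R]_(x in `[a, b]) (f x ^+ 2)%:E < +oo)%E.
  have mI : measurable (`[a, b] : set (measurableTypeR R)) by exact: measurable_itv.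
  by have := integrable_fin_num mI i2; rewrite fin_numElt => /andP[].
apply: le_lt_trans; rewrite [leRHS]integral_mkcond le_eqVlt; apply/predU1P; left.
apply: eq_integral => x _ /=; rewrite !patchE; case: ifPn => _.
  by rewrite powR_mulrn// real_normK// num_real.
by rewrite /point/= normr0 powR0// pnatr_eq0.
Qed.

(** On a bounded interval 1 + f^2 is integrable, and it dominates |f| because (|f| - 1)^2 >= 0. *)
Lemma Lfun2_restrict_integrable (R : realType) (a b : R) (f : R -> R) :
  f \_ `[a, b] \in Lfun (@lebesgue_measure R) 2%:E ->
  (@lebesgue_measure R).-integrable `[a, b] (EFin \o f).
Proof.
move=> l2f.
have mI : measurable (`[a, b] : set (measurableTypeR R)) by exact: measurable_itv.
have mf : measurable_fun `[a, b] f.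
  apply/(measurable_restrictT _ _).2 => //.
  by have := sub_Lfun_mfun l2f; rewrite inE.
have i1 : (@lebesgue_measure R).-integrable `[a, b] (EFin \o cst (1 : R)).
  apply: continuous_compact_integrable; first exact: segment_compact.
  by apply: continuous_subspaceT => x; exact: cvg_cst.
have i2 := integrableS measurableT mI (@subsetT _ _) (Lfun2_integrable_sqr l2f).
apply: le_integrable (integrableD mI i1 i2) => //; first exact/measurable_EFinP.
move=> x xab; rewrite /= patchE mem_set// lee_fin.
rewrite [leRHS]ger0_norm ?addr_ge0 ?sqr_ge0//.
have := sqr_ge0 (`|f x| - 1); rewrite sqrrB1 real_normK ?num_real//.
have := normr_ge0 (f x); lra.
Qed.

(** * Energy of Ornstein-Uhlenbeck paths *)

(* Integrates [2 u v - v ^+ 2 <= u ^+ 2] against the control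
   [v t = kappa * lam * expR (c * (t - T))], which is optimal for a suitable
   [kappa]. *)
Lemma OU_cost_ge (R : realType) (T c lam mu0 kappa : R) (phi g : R -> R) :
  let mu := @lebesgue_measure R in
  0 < T -> 0 < c -> 0 < lam ->
  mu.-integrable `[0, T] (EFin \o phi) ->
  (forall t, t \in `[0, T] -> g t = mu0 + \int[mu]_(s in `[0, t]) phi s) ->
  ((kappa * (g T - mu0)
      - kappa ^+ 2 / 4 * (lam ^+ 2 / c * (1 - expR (- (2 * c * T)))))%:E <=
   (2^-1)%:E * \int[mu]_(t in `[0%R, T])
     (((derive1 g t - c * (mu0 - g t)) / lam) ^+ 2)%:E)%E.
Proof.
move=> mu T0 c0 lam0 iphi gE.
pose E s := expR (c * s + - (c * T)).
pose X s := \int[mu]_(r in `[0, s]) phi r.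
have mT : measurable (`[0, T] : set (measurableTypeR R)) by exact: measurable_itv.
(* The integral of E (phi + c X) equals g(T) - mu0, so the term linear in the control depends on the
   path only through its end point. *)
have [iEX EX] := Rintegral_duhamel c iphi.
rewrite -/E -/mu in iEX EX.
pose E2 s := expR (2 * c * s + - (2 * c * T)).
have cE2 : continuous E2 by exact: continuous_expR_affine.
have cE2' : continuous (fun s => 2 * c * E2 s).
  by move=> x; apply: cvgM; [exact: cvg_cst|exact: cE2].
have iE2 : mu.-integrable `[0, T] (EFin \o E2).
  apply: continuous_compact_integrable; first exact: segment_compact.
  exact: continuous_subspaceT.
have IE2 : \int[mu]_(s in `[0, T]) E2 s = (2 * c)^-1 * (1 - expR (- (2 * c * T))).
  have c2 : 2 * c != 0 by rewrite mulf_neq0 ?gt_eqF.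
  apply: (mulfI c2); rewrite mulVKf// -RintegralZl// /Rintegral.
  rewrite (derivable_continuous_FTC2 (derive_expR_affine _ _) cE2' (ltW T0))/=.
  by rewrite subrr expR0 mulr0 add0r.
have E2E s : E s ^+ 2 = E2 s.
  rewrite /E /E2 -expRM_natl; congr expR; rewrite mulr_natl; ring.
(* This is 2 u v - v^2 for u = (phi + c X) / lam and v = kappa lam E. *)
pose f1 s := 2 * kappa * (E s * (phi s + c * X s)) - (kappa ^+ 2 * lam ^+ 2) * E2 s.
have i1 : mu.-integrable `[0, T]
    (EFin \o (fun s => 2 * kappa * (E s * (phi s + c * X s)))).
  by have := integrableZl mT (2 * kappa) iEX; apply.
have i2 : mu.-integrable `[0, T] (EFin \o (fun s => kappa ^+ 2 * lam ^+ 2 * E2 s)).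
  by have := integrableZl mT (kappa ^+ 2 * lam ^+ 2) iE2; apply.
have if1 : mu.-integrable `[0, T] (EFin \o f1).
  by have := integrableB mT i1 i2; apply.
have If1 : \int[mu]_(s in `[0, T]) f1 s = 2 * kappa * (g T - mu0)
    - kappa ^+ 2 / 2 * (lam ^+ 2 / c * (1 - expR (- (2 * c * T)))).
  rewrite RintegralB// RintegralZl// EX RintegralZl// IE2 gE; last first.
    by rewrite in_itv/= ltW//=.
  rewrite -/mu (addrC mu0) addrK; field; by rewrite ?lt0r_neq0.
rewrite [leLHS](_ : _ = ((2^-1)%:E * \int[mu]_(s in `[0%R, T]) (f1 s)%:E)%E);
  last first.
  rewrite -EFin_Rintegral// If1 -EFinM; congr EFin; field; by rewrite ?lt0r_neq0.
apply: lee_wpmul2l; first by rewrite lee_fin.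
apply: ae_le_integral_nonmeasurable => //.
  by move=> t _; rewrite lee_fin sqr_ge0.
apply: (@filterS _ _ (ae_filter_ringOfSetsType mu) _ _ _
  (ae_derive1_primitive iphi gE)) => t g't tT.
rewrite g't// gE// lee_fin -subr_ge0.
set x := (_ / lam).
have -> : x ^+ 2 - f1 t = (x - kappa * lam * E t) ^+ 2.
  rewrite /x /f1 -E2E -/mu -/(X t); field; by rewrite ?lt0r_neq0.
exact: sqr_ge0.
Qed.

(* The path from [mu0] driven by the control
   [kappa * lam * expR (c * (t - T))]. *)
Definition OU_path (R : realType) (T c lam mu0 kappa t : R) : R :=
  mu0 + kappa * lam ^+ 2 / (2 * c)
    * (expR (c * t + - (c * T)) - expR (- c * t + - (c * T))).

(** Equals kappa lam^2 e^{-cT} cosh(ct); likewise [OU_path] is mu0 + (kappa lam^2 / c) e^{-cT}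
    sinh(ct). *)
Definition OU_velocity (R : realType) (T c lam kappa t : R) : R :=
  kappa * lam ^+ 2 / 2
    * (expR (c * t + - (c * T)) + expR (- c * t + - (c * T))).

Lemma continuous_OU_velocity (R : realType) (T c lam kappa : R) :
  continuous (OU_velocity T c lam kappa).
Proof.
move=> x; apply: cvgM; first exact: cvg_cst.
by apply: cvgD; exact: continuous_expR_affine.
Qed.

Lemma derive_OU_path (R : realType) (T c lam mu0 kappa t : R) : 0 < c ->
  is_derive t 1 (OU_path T c lam mu0 kappa) (OU_velocity T c lam kappa t).
Proof.
move=> c0.
have d1 := derive_expR_affine c (- (c * T)) t.
have d2 := derive_expR_affine (- c) (- (c * T)) t.
have d3 := is_deriveB d1 d2.
have d4 := is_deriveZ (kappa * lam ^+ 2 / (2 * c)) d3.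
have d5 := is_deriveD (is_derive_cst mu0 t 1) d4.
apply: is_derive_eq d5 _.
by rewrite /OU_velocity /GRing.scale/=; field; rewrite lt0r_neq0.
Qed.

Lemma OU_path_primitive (R : realType) (T c lam mu0 kappa t : R) :
  0 < c -> 0 <= t ->
  OU_path T c lam mu0 kappa t =
    mu0 + \int[@lebesgue_measure R]_(s in `[0, t]) OU_velocity T c lam kappa s.
Proof.
move=> c0 t0; rewrite /Rintegral.
rewrite (derivable_continuous_FTC2
  (fun s => derive_OU_path T lam mu0 kappa s c0)
  (@continuous_OU_velocity _ T c lam kappa) t0)/=.
by rewrite /OU_path !mulr0 subrr mulr0 addr0 [mu0 + (_ - _)]addrC subrK.
Qed.

Lemma OU_path_end (R : realType) (T c lam mu0 kappa : R) :
  OU_path T c lam mu0 kappa T =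
    mu0 + kappa / 2 * (lam ^+ 2 / c * (1 - expR (- (2 * c * T)))).
Proof.
rewrite /OU_path subrr expR0.
have -> : - c * T + - (c * T) = - (2 * c * T) by ring.
by rewrite invfM; ring.
Qed.

(** In g' + c (g - mu0) the decaying exponentials cancel, leaving kappa lam^2 e^{c(t - T)}. By
    [OU_path_end] the resulting cost is exactly the lower bound of [OU_cost_ge] for the same
    [kappa]. *)
Lemma OU_path_cost (R : realType) (T c lam mu0 kappa : R) :
  0 < T -> 0 < c -> 0 < lam ->
  ((2^-1)%:E * \int[@lebesgue_measure R]_(t in `[0%R, T])
     (((derive1 (OU_path T c lam mu0 kappa) t
        - c * (mu0 - OU_path T c lam mu0 kappa t)) / lam) ^+ 2)%:E)%E =
  (kappa ^+ 2 / 4 * (lam ^+ 2 / c * (1 - expR (- (2 * c * T)))))%:E.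
Proof.
move=> T0 c0 lam0.
pose q := kappa ^+ 2 * lam ^+ 2 / (2 * c).
pose F s := q * expR (2 * c * s + - (2 * c * T)).
pose f s := kappa ^+ 2 * lam ^+ 2 * expR (2 * c * s + - (2 * c * T)).
have dF (s : R) : is_derive s 1 F (f s).
  have := is_deriveZ q (derive_expR_affine (2 * c) (- (2 * c * T)) s).
  move=> /is_derive_eq; apply.
  by rewrite /f /q /GRing.scale/=; field; rewrite lt0r_neq0.
have cf : continuous f.
  by move=> x; apply: cvgM; [exact: cvg_cst|exact: continuous_expR_affine].
transitivity ((2^-1)%:E * \int[@lebesgue_measure R]_(t in `[0%R, T]) (f t)%:E)%E.
  congr (_ * _)%E; apply: eq_integral => t _; congr EFin.
  have dg := derive_OU_path T lam mu0 kappa t c0.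
  rewrite derive1E derive_val /OU_velocity /OU_path /f.
  have -> : expR (2 * c * t + - (2 * c * T)) = expR (c * t + - (c * T)) ^+ 2.
    by rewrite -expRM_natl; congr expR; rewrite mulr_natl; ring.
  by field; rewrite ?lt0r_neq0.
rewrite (derivable_continuous_FTC2 dF cf (ltW T0)) -EFinM; congr EFin.
rewrite /F /q subrr expR0 mulr0 add0r; field; by rewrite lt0r_neq0.
Qed.

(** * The reduced Laplacian *)

Section network_flow.
Variables (R : realType) (N : nat) (G : network R N).

Lemma network_potential_const (f : 'I_N.+1 -> R) :
  (forall k, f (src (n:=G) k) = f (dst k)) -> forall i j, f i = f j.
Proof.
move=> fG i j; have /connectP[q + ->] := network_connected G i j.
elim: q i => //= a q IH i /andP[/existsP[k kE] /IH <-].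
by case/orP: kE => /andP[/eqP <- /eqP <-].
Qed.

Lemma incidence_mulmx (n : nat) (v : 'M[R]_(N.+1, n)) k j :
  (incidence G *m v) k j = v (src k) j - v (dst k) j.
Proof.
rewrite mxE (bigD1 (src k))//= (bigD1 (dst k))/=; last by rewrite eq_sym src_neq_dst.
rewrite !mxE eqxx eq_sym (negbTE (src_neq_dst k)) eqxx mul1r mulN1r.
rewrite big1 ?addr0// => i /andP[/negbTE ik /negbTE jk].
by rewrite !mxE ik jk mul0r.
Qed.

(** A vector in the left kernel, extended by potential 0 at node 0, has zero energy: a sum over the
    lines of weight times squared potential difference. Positive weights make every difference
    vanish, so connectedness makes the potential constant, hence 0. *)
Lemma Bhat_unitmx : Bhat G \in unitmx.
Proof.
rewrite -row_free_unit -kermx_eq0; apply/eqP/row_matrixP => r; rewrite row0.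
have := sub_kermxP (row_sub r (kermx (Bhat G))).
move: (row r _) => u uB0.
pose w : 'cV[R]_N.+1 := \col_a (if unlift ord0 a is Some i then u 0 i else 0).
have w0 : w ord0 0 = 0 by rewrite mxE unlift_none.
have wl i : w (lift ord0 i) 0 = u 0 i by rewrite mxE liftK.
have : (w^T *m Bmx G *m w) 0 0 = 0.
  transitivity ((u *m Bhat G *m u^T) 0 0); last by rewrite uB0 mul0mx mxE.
  rewrite !mxE big_ord_recl w0 mulr0 add0r; apply: eq_bigr => j _.
  rewrite wl ![in LHS]mxE ![in RHS]mxE big_ord_recl [w^T _ _]mxE w0 mul0r add0r.
  by congr (_ * _); apply: eq_bigr => i _; rewrite [w^T _ _]mxE wl !mxE.
pose x := incidence G *m w.
have -> : w^T *m Bmx G *m w = x^T *m weight_mx G *m x.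
  by rewrite /Bmx trmx_mul !mulmxA.
rewrite mxE (eq_bigr (fun k => weight k * x k 0 ^+ 2)) => [/eqP|k _]; last first.
  by rewrite mul_mx_diag !mxE expr2; ring.
rewrite psumr_eq0 => [/allP x0|k _]; last by rewrite mulr_ge0 ?sqr_ge0 ?ltW ?weight_gt0.
have wE : forall i j, w i 0 = w j 0.
  apply: network_potential_const => k; apply/eqP; rewrite -subr_eq0 -incidence_mulmx.
  have /= := x0 k (mem_index_enum _).
  by rewrite mulf_eq0 sqrf_eq0 (gt_eqF (weight_gt0 k)).
by apply/rowP => i; rewrite -wl (wE _ ord0) w0 mxE.
Qed.

Lemma Cbar_entry k (j : 'I_N.+1) :
  Cbar G k j = (Imax k)^-1 * weight k * (Bbreve G (src k) j - Bbreve G (dst k) j).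
Proof.
rewrite /Cbar -mulmxA /Lambda_mx /weight_mx mulmx_diag mul_diag_mx mxE.
by rewrite incidence_mulmx !mxE.
Qed.

Lemma Bbreve_row0 (j : 'I_N.+1) : Bbreve G ord0 j = 0.
Proof.
have -> : (ord0 : 'I_N.+1) = lshift N (ord0 : 'I_1) by apply: ord_inj.
rewrite /Bbreve !mxE; case: splitP => i //= _.
by rewrite !mxE; case: splitP => ? _; rewrite mxE.
Qed.

Lemma Bbreve_lift (i j : 'I_N) :
  Bbreve G (lift ord0 i) (lift ord0 j) = invmx (Bhat G) i j.
Proof.
have e (a : 'I_N) : lift ord0 a = rshift 1 a by apply: ord_inj.
rewrite !e; exact: block_mxEdr.
Qed.

(** If [Cmx] vanished, column 1 of [Bbreve] would have equal entries at the ends of each line, so it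
    would be constant, and zero by its entry at node 0. The inverse of [Bhat] would then have a zero
    column. *)
Lemma exists_Lprime (m : nat) : (1 <= m)%N -> (m <= N)%N ->
  exists k, Lprime G m k.
Proof.
move=> m1 mN; apply/existsP; apply: contraT; rewrite negb_exists => /forallP noL.
have N0 : (0 < N)%N by exact: leq_trans mN.
(* Index 0 of the reduced matrix is node 1, which also labels the first column of [Cmx]. *)
pose j : 'I_N := Ordinal N0.
have jE : inord 1 = lift ord0 j :> 'I_N.+1 by apply: val_inj; rewrite /= inordK.
have flat : forall a b, Bbreve G a (lift ord0 j) = Bbreve G b (lift ord0 j).
  apply: network_potential_const => k; have := noL k; rewrite negbK.
  move=> /eqP/rowP/(_ (Ordinal m1)).
  rewrite [X in X = _]mxE [X in X = _]mxE [X in _ = X]mxE /= jE Cbar_entry => /eqP.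
  rewrite mulf_eq0 mulf_eq0 invr_eq0 (gt_eqF (Imax_gt0 k)) (gt_eqF (weight_gt0 k))/=.
  by rewrite subr_eq0 => /eqP.
have col0 i : invmx (Bhat G) i j = 0.
  by rewrite -Bbreve_lift (flat _ ord0) Bbreve_row0.
have := mulmxV Bhat_unitmx => /matrixP/(_ j j); rewrite !mxE eqxx.
rewrite big1 => [/eqP|i _]; last by rewrite col0 mulr0.
by rewrite eq_sym oner_eq0.
Qed.

End network_flow.

(** * Diagonal matrices *)

Lemma expr_diag_mx (R : realType) (m k : nat) (d : 'rV[R]_m) :
  diag_mx d ^+ k = diag_mx (\row_i d 0 i ^+ k).
Proof.
elim: k => [|k IH].
  by apply/matrixP => i j; rewrite expr0 !mxE expr0.
rewrite exprS IH -[LHS]/(diag_mx d *m _) mulmx_diag; congr diag_mx.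
by apply/rowP => i; rewrite !mxE exprS.
Qed.

Lemma expmx_diag (R : realType) (m : nat) (d : 'rV[R]_m) :
  expmx (diag_mx d) = diag_mx (\row_i expR (d 0 i)).
Proof.
apply/matrixP => i j; rewrite !mxE.
have -> : (fun n => (\sum_(0 <= k < n) (k`!%:R)^-1 *: diag_mx d ^+ k) i j) =
    (fun n => (series (exp_coeff (d 0 i)) n) *+ (i == j)).
  apply/funext => n; rewrite summxE /series/= -sumrMnl; apply: eq_bigr => k _.
  by rewrite expr_diag_mx !mxE /exp_coeff/= mulrnAr mulrC.
case: (i == j) => /=; first by under eq_fun do rewrite mulr1n.
by under eq_fun do rewrite mulr0n; exact: lim_cst.
Qed.

Lemma invmx_diag (R : realType) (m : nat) (d : 'rV[R]_m) :
  (forall i, d 0 i != 0) -> invmx (diag_mx d) = diag_mx (\row_i (d 0 i)^-1).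
Proof.
move=> d0.
have dd : diag_mx d *m diag_mx (\row_i (d 0 i)^-1) = 1%:M.
  by apply/matrixP => i j; rewrite mulmx_diag !mxE mulfV.
have [du _] := mulmx1_unit dd.
by rewrite -[LHS]mulmx1 -dd mulmxA mulVmx// mul1mx.
Qed.

Lemma quad_diag_mx (R : realType) (m : nat) (v d : 'rV[R]_m) :
  (v *m diag_mx d *m v^T) 0 0 = \sum_i v 0 i ^+ 2 * d 0 i.
Proof.
rewrite mxE; apply: eq_bigr => i _.
by rewrite mul_mx_diag !mxE mulrAC expr2.
Qed.

(** M_T is diagonal; its i-th entry is twice the integral over [0, T] of the square of lam_i
    e^{-gam_i (T - s)}. *)
Lemma OU_covariance_mx (R : realType) (m : nat) (T : R) (gam lam : 'rV[R]_m) :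
  (forall i, 0 < gam 0 i) ->
  diag_mx lam ^+ 2 *m invmx (diag_mx gam)
    *m (1%:M - expmx ((- 2 * T) *: diag_mx gam)) =
  diag_mx (\row_i (lam 0 i ^+ 2 / gam 0 i * (1 - expR (- (2 * gam 0 i * T))))).
Proof.
move=> gam0; rewrite expr_diag_mx invmx_diag => [|i]; last by rewrite gt_eqF.
have -> : (- 2 * T) *: diag_mx gam = diag_mx (\row_i (- (2 * gam 0 i * T))).
  by apply/matrixP => i j; rewrite !mxE mulrnAr; congr (_ *+ _); ring.
rewrite expmx_diag -[1%:M]diag_const_mx -raddfB/= !mulmx_diag.
by congr diag_mx; apply/rowP => i; rewrite !mxE.
Qed.

(** * The constrained minimum *)

Lemma OU_var_gt0 (R : realType) (T c lam : R) : 0 < T -> 0 < c -> 0 < lam ->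
  0 < lam ^+ 2 / c * (1 - expR (- (2 * c * T))).
Proof.
move=> T0 c0 lam0; rewrite mulr_gt0 ?divr_gt0 ?exprn_gt0// subr_gt0.
by rewrite expR_lt1 oppr_lt0 !mulr_gt0.
Qed.

Lemma OU_quad_gt0 (R : realType) (N : nat) (G : network R N) (m : nat) (T : R)
    (gam lam : 'rV[R]_m) k :
  0 < T -> (forall i, 0 < gam 0 i) -> (forall i, 0 < lam 0 i) ->
  Lprime G m k ->
  0 < \sum_i Cmx G m k i ^+ 2
        * (lam 0 i ^+ 2 / gam 0 i * (1 - expR (- (2 * gam 0 i * T)))).
Proof.
move=> T0 gam0 lam0 /rV0Pn[j]; rewrite mxE => Cj.
rewrite (bigD1 j)//= ltr_wpDr//.
  apply: sumr_ge0 => i _; apply: mulr_ge0; first exact: sqr_ge0.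
  exact/ltW/OU_var_gt0.
by rewrite mulr_gt0 ?OU_var_gt0// exprn_even_gt0.
Qed.

(** One choice of multipliers serves both bounds: the paths [OU_path] attain the value, and
    [OU_cost_ge], summed over the coordinates, shows that no admissible path does better. *)
Lemma psi_OU (R : realType) (N : nat) (G : network R N) (m : nat) (T : R)
    (gam lam : 'rV[R]_m) (b l : 'cV[R]_m -> 'I_m -> R -> R) (mub : mean R N m)
    (k : 'I_(nlines G)) (a : R) :
  0 < T -> (forall i, 0 < gam 0 i) -> (forall i, 0 < lam 0 i) ->
  (forall mu i x, b mu i x = gam 0 i * (mu i 0 - x)) ->
  (forall mu i x, l mu i x = lam 0 i) ->
  Lprime G m k ->
  psi T b l mub k a =
  ((a - nu G mub k 0) ^+ 2
    / \sum_i Cmx G m k i ^+ 2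
        * (lam 0 i ^+ 2 / gam 0 i * (1 - expR (- (2 * gam 0 i * T)))))%:E.
Proof.
move=> T0 gam0 lam0 b_OU l_OU kL.
pose W i := lam 0 i ^+ 2 / gam 0 i * (1 - expR (- (2 * gam 0 i * T))).
have Q0 := OU_quad_gt0 T0 gam0 lam0 kL.
rewrite -/W in Q0 *.
set Q := \sum_i _ in Q0 *.
set mu := mub.1; set d := a - nu G mub k 0.
(* Stationarity makes [kappa] proportional to row k of C. As coordinate i ends at distance kappa_i
   W_i / 2 from its mean, the constraint forces the factor 2 d / Q. *)
pose kappa i := 2 * d / Q * Cmx G m k i.
have Ipow_OU g : Ipow T (b mu) (l mu) g =
    (\sum_(i < m) (2^-1)%:E * \int[@lebesgue_measure R]_(t in `[0%R, T])
      (((derive1 (fun s => g s i 0) t - gam 0 i * (mu i 0 - g t i 0))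
          / lam 0 i) ^+ 2)%:E)%E.
  apply: eq_bigr => i _; congr (_ * _)%E; apply: eq_integral => t _.
  by rewrite b_OU l_OU.
have constraintE (v : 'cV[R]_m) : yvec G mub k 0 + (row k (Cmx G m) *m v) 0 0 =
    nu G mub k 0 + \sum_i Cmx G m k i * (v i 0 - mu i 0).
  rewrite /nu; set y := yvec G mub.
  rewrite [(_ + y) k 0]mxE [RHS]addrAC [RHS]addrC; congr (_ + _).
  rewrite !mxE -big_split; apply: eq_bigr => i _ /=.
  by rewrite mxE -/mu mulrBr addrC subrK.
apply/eqP; rewrite eq_le; apply/andP; split.
- apply: ereal_inf_lbound.
  pose g t := \col_i OU_path T (gam 0 i) (lam 0 i) (mu i 0) (kappa i) t.
  have gE t i : g t i 0 = OU_path T (gam 0 i) (lam 0 i) (mu i 0) (kappa i) t.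
    by rewrite mxE.
  exists g; first split.
  + exists (fun t => \col_i OU_velocity T (gam 0 i) (lam 0 i) (kappa i) t).
      move=> i.
      have -> : (fun t => (\col_j OU_velocity T (gam 0 j) (lam 0 j) (kappa j) t) i 0)
          = OU_velocity T (gam 0 i) (lam 0 i) (kappa i).
        by apply/funext => t; rewrite mxE.
      exact/continuous_restrict_Lfun2/continuous_OU_velocity.
    move=> t; rewrite in_itv/= => /andP[t0 _]; apply/colP => i.
    rewrite !mxE OU_path_primitive//; congr (_ + _); apply: eq_Rintegral => s _.
    by rewrite mxE.
  + rewrite constraintE.
    under eq_bigr do rewrite gE OU_path_end addrAC subrr add0r -/(W _).
    rewrite (eq_bigr (fun i => d / Q * (Cmx G m k i ^+ 2 * W i))) => [|i _].
      by rewrite -mulr_sumr -/Q divfK ?gt_eqF// /d addrC subrK.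
    by rewrite /kappa; field; rewrite gt_eqF.
  + rewrite Ipow_OU.
    under eq_bigr => i _.
      rewrite (_ : (fun s => g s i 0) =
        OU_path T (gam 0 i) (lam 0 i) (mu i 0) (kappa i)); last first.
        by apply/funext => s; rewrite gE.
      under eq_integral do rewrite gE.
      rewrite OU_path_cost// -/(W i).
      over.
    rewrite sumEFin; congr EFin.
    rewrite (eq_bigr (fun i => d ^+ 2 / Q ^+ 2 * (Cmx G m k i ^+ 2 * W i))) => [|i _].
      by rewrite -mulr_sumr -/Q; field; rewrite gt_eqF.
    by rewrite /kappa; field; rewrite gt_eqF.
- apply: le_ereal_inf_tmp => _ [g [[phi phi2 gE] gT] <-]; rewrite Ipow_OU.
  (* With these multipliers the linear terms add up to 2 d^2 / Q by the constraint, and the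
     quadratic ones to d^2 / Q. *)
  have -> : d ^+ 2 / Q =
      \sum_i (kappa i * (g T i 0 - mu i 0) - kappa i ^+ 2 / 4 * W i).
    rewrite sumrB (eq_bigr (fun i => 2 * d / Q * (Cmx G m k i * (g T i 0 - mu i 0)))).
      rewrite -mulr_sumr [X in _ - X](eq_bigr
        (fun i => d ^+ 2 / Q ^+ 2 * (Cmx G m k i ^+ 2 * W i))) => [|i _].
        rewrite -mulr_sumr -/Q.
        have -> : \sum_i Cmx G m k i * (g T i 0 - mu i 0) = d.
          by rewrite /d -gT constraintE addrAC subrr add0r.
        by field; rewrite gt_eqF.
      by rewrite /kappa; field; rewrite gt_eqF.
    by move=> i _; rewrite mulrA.
  rewrite -sumEFin; apply: lee_sum => i _.
  apply: (@OU_cost_ge _ T (gam 0 i) (lam 0 i) (mu i 0) (kappa i)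
    (fun t => phi t i 0) (fun t => g t i 0)) => //.
    exact/Lfun2_restrict_integrable/phi2.
  by move=> t tT; rewrite gE// !mxE.
Qed.

(** * Scalar inequalities for the overload margin, with q = e^{-T/tau}, s = |nu| *)

Lemma le_sqrtr (R : rcfType) (x y : R) : 0 <= x -> 0 <= y ->
  (x <= Num.sqrt y) = (x ^+ 2 <= y).
Proof.
by move=> x0 y0; rewrite -[in RHS](sqr_sqrtr y0) ler_sqr ?nnegrE ?sqrtr_ge0.
Qed.

(** After squaring and clearing 1 - q, the difference of the two sides is 1 - s^2. So alpha - |nu|
    >= 0 on admissible points, and squared margins can be compared without squares. *)
Lemma overload_margin (R : rcfType) (q s : R) : 0 < q < 1 -> 0 <= s <= 1 ->
  s <= Num.sqrt ((1 - s ^+ 2 * q) / (1 - q)).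
Proof.
move=> /andP[q0 q1] /andP[s0 s1].
have q1' : 0 < 1 - q by rewrite subr_gt0.
have s2 : s ^+ 2 <= 1 by rewrite expr_le1.
have y0 : 0 <= 1 - s ^+ 2 * q by nra.
rewrite le_sqrtr ?divr_ge0 ?(ltW q1')// ler_pdivlMr//; nra.
Qed.

Lemma overload_margin_ge (R : rcfType) (q s eta : R) :
  0 < q < 1 -> 0 <= s <= 1 -> 0 <= eta < 1 ->
  (eta ^+ 2 <= (Num.sqrt ((1 - s ^+ 2 * q) / (1 - q)) - s) ^+ 2) =
  (s <= Num.sqrt (1 - eta ^+ 2 * q * (1 - q)) - eta * (1 - q)).
Proof.
move=> hq hs /andP[e0 e1].
have /andP[q0 q1] := hq; have /andP[s0 s1] := hs.
have q1' : 0 < 1 - q by rewrite subr_gt0.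
have s2 : s ^+ 2 <= 1 by rewrite expr_le1.
have e2 : eta ^+ 2 <= 1 by rewrite expr_le1// ltW.
have y0 : 0 <= 1 - s ^+ 2 * q by nra.
have z0 : 0 <= 1 - eta ^+ 2 * q * (1 - q).
  have p0 : 0 <= q * (1 - q) by rewrite mulr_ge0 ?ltW.
  have p1 : q * (1 - q) <= 1 by nra.
  by rewrite subr_ge0 -mulrA mulr_ile1 ?sqr_ge0.
rewrite ler_sqr ?nnegrE// ?subr_ge0 ?overload_margin//.
have x0 : 0 <= (1 - s ^+ 2 * q) / (1 - q) by rewrite divr_ge0 ?(ltW q1').
rewrite !lerBrDr (le_sqrtr _ x0) ?addr_ge0// (le_sqrtr _ z0); last first.
  by rewrite addr_ge0 ?mulr_ge0 ?(ltW q1').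
(* Both sides now assert that the same polynomial, 1 - s^2 - 2 eta (1 - q) s - eta^2 (1 - q), is
   nonnegative; [delta] comes from completing its square in s. *)
rewrite ler_pdivlMr// -[LHS]subr_ge0 -[RHS]subr_ge0; congr (0 <= _); ring.
Qed.

Theorem mainTheorem9 (R : realType) (N : nat) (G : network R N) (m : nat)
    (m_ge1 : (1 <= m)%N) (m_leN : (m <= N)%N)
    (T : R) (T_gt0 : 0 < T)
    (tau : 'I_(nlines G) -> R) (tau_gt0 : forall k, 0 < tau k)
    (eps : R) (eps_gt0 : 0 < eps) (p : R) (p_gt0 : 0 < p) (p_lt1 : p < 1)
    (gam lam : 'rV[R]_m)
    (gam_gt0 : forall i, 0 < gam 0 i) (lam_gt0 : forall i, 0 < lam 0 i)
    (b l : 'cV[R]_m -> 'I_m -> R -> R)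
    (b_OU : forall (mu : 'cV[R]_m) (i : 'I_m) (x : R),
       b mu i x = gam 0 i * (mu i 0 - x))
    (l_OU : forall (mu : 'cV[R]_m) (i : 'I_m) (x : R), l mu i x = lam 0 i) :
  let D := diag_mx gam in
  let L := diag_mx lam in
  let C := Cmx G m in
  let M := L ^+ 2 *m invmx D *m (1%:M - expmx ((- 2 * T) *: D)) in
  let quotient (mub : mean R N m) (k : 'I_(nlines G)) : R :=
    (alpha T tau mub k - `|nu G mub k 0|) ^+ 2
      / (row k C *m M *m (row k C)^T) 0 0 in
  [/\ forall mub, admissible G mub ->
        I_LB T tau b l mub =
          (\big[mine/+oo]_(k | Lprime G m k) (quotient mub k)%:E)%E,
      R_LB T tau b l eps p =
        \bigcap_(k in [set k | Lprime G m k])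
          [set mub | admissible G mub /\ - eps * ln p <= quotient mub k]
    & forall gamma : R, 0 < gamma -> D = gamma%:M ->
        let sigma2 k := (row k C *m L ^+ 2 *m (row k C)^T) 0 0 in
        let eta k :=
          Num.sqrt (eps * ln (1 / p) * sigma2 k * (1 - expR (- 2 * gamma * T))
                    / gamma) in
        let delta k :=
          Num.sqrt (1 - eta k ^+ 2 * expR (- T / tau k)
                          * (1 - expR (- T / tau k)))
            - eta k * (1 - expR (- T / tau k)) in
        (forall k, Lprime G m k -> eta k < 1) ->
        R_LB T tau b l eps p =
          \bigcap_(k in [set k | Lprime G m k])
            [set mub | admissible G mub /\ `|nu G mub k 0| <= delta k]].
Proof.
move=> D L C M quotient.
pose W i := lam 0 i ^+ 2 / gam 0 i * (1 - expR (- (2 * gam 0 i * T))).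
pose Q k := \sum_i Cmx G m k i ^+ 2 * W i.
have Q_gt0 k : Lprime G m k -> 0 < Q k by exact: OU_quad_gt0.
have quadE k : (row k C *m M *m (row k C)^T) 0 0 = Q k.
  rewrite /M /D /L OU_covariance_mx// quad_diag_mx; apply: eq_bigr => i _.
  by rewrite [row k C 0 i]mxE; congr (_ * _); rewrite mxE.
have q01 k : 0 < expR (- T / tau k) < 1.
  by rewrite expR_gt0 expR_lt1 mulNr oppr_lt0 divr_gt0.
have psi_min mub k : Lprime G m k ->
    mine (psi T b l mub k (alpha T tau mub k))
      (psi T b l mub k (- alpha T tau mub k)) = (quotient mub k)%:E.
  move=> kL; rewrite !(psi_OU _ _ T_gt0 gam_gt0 lam_gt0 b_OU l_OU kL) -/W -/(Q k).
  rewrite -EFin_min /quotient quadE; congr EFin.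
  have := sqrtr_ge0 ((1 - nu G mub k 0 ^+ 2 * expR (- T / tau k))
            / (1 - expR (- T / tau k))).
  rewrite -/(alpha T tau mub k); move: (alpha _ _ _ _) (nu _ _ _ _) => a v a0.
  rewrite -minr_pMl ?invr_ge0 ?ltW ?Q_gt0//; congr (_ / _).
  (* As a >= 0, the nearer of a and -a to v is the one with the sign of v, at distance |a - |v||. *)
  by case: (ger0P v) => v0; case: leP; nra.
have I_LB_quotient mub : I_LB T tau b l mub =
    (\big[mine/+oo]_(k | Lprime G m k) (quotient mub k)%:E)%E.
  by apply: eq_bigr => k; exact: psi_min.
have R_LB_quotient : R_LB T tau b l eps p =
    \bigcap_(k in [set k | Lprime G m k])
      [set mub | admissible G mub /\ - eps * ln p <= quotient mub k].
  apply/seteqP; split => mub /=.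
    move=> [adm]; rewrite I_LB_quotient => /bigmin_geP[_ le_q] k kL.
    by split => //; rewrite -lee_fin; exact: le_q.
  (* A line of L' is needed to extract admissibility: an empty intersection would be the whole
     space. *)
  move=> adm; have [k0 k0L] := exists_Lprime G m_ge1 m_leN.
  split; first by case: (adm k0 k0L).
  rewrite I_LB_quotient; apply/bigmin_geP; split; first exact: leey.
  by move=> k kL; rewrite lee_fin; case: (adm k kL).
split => //.
move=> gamma gamma0 DE sigma2 eta delta eta1.
have gamE i : gam 0 i = gamma.
  by have /matrixP/(_ i i) := DE; rewrite !mxE eqxx !mulr1n.
(* For D = gamma I, Q_k = sigma_k^2 (1 - e^{-2 gamma T}) / gamma. Hence the threshold on the
   quotient reads eta_k^2 <= (alpha_k - |nu_k|)^2. *)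
have etaE k : Lprime G m k -> eta k ^+ 2 = - eps * ln p * Q k.
  move=> kL; have QE : Q k = sigma2 k * (1 - expR (- 2 * gamma * T)) / gamma.
    rewrite /sigma2 /L expr_diag_mx quad_diag_mx !mulr_suml; apply: eq_bigr => i _.
    rewrite [row k C 0 i]mxE [(\row__ _) _ _]mxE /W gamE.
    have -> : - (2 * gamma * T) = - 2 * gamma * T by ring.
    by rewrite /C; ring.
  have e : eps * ln (1 / p) * sigma2 k * (1 - expR (- 2 * gamma * T)) / gamma
      = - eps * ln p * Q k.
    by rewrite QE div1r lnV ?posrE//; ring.
  rewrite /eta e sqr_sqrtr// mulr_ge0 ?ltW ?Q_gt0//.
  by rewrite mulNr -mulrN mulr_gt0// oppr_gt0 ln_lt0// p_gt0.
have bound_iff mub k : admissible G mub -> Lprime G m k ->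
    (- eps * ln p <= quotient mub k) = (`|nu G mub k 0| <= delta k).
  move=> [nu1 _] kL; rewrite /quotient quadE ler_pdivlMr ?Q_gt0// -etaE//.
  rewrite /alpha -[nu G mub k 0 ^+ 2]real_normK ?num_real//.
  by rewrite overload_margin_ge// ?normr_ge0 ?nu1 ?sqrtr_ge0 ?eta1.
rewrite R_LB_quotient; apply/seteqP; split => mub adm k kL.
  by have [a le] := adm k kL; split => //; rewrite -bound_iff.
by have [a le] := adm k kL; split => //; rewrite bound_iff.
Qed.
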